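(* Let $h:\kappa\to\kappa$ be any function. If $\mathfrak{b}_h(\in^* )\geq\lambda$, then for every $\sigma$-complete ultrafilter $U$ on $\kappa$ and every set $X\subseteq j_U(\kappa)$ with $|X|^V<\lambda$, there is $Y\in M_U$ such that $M_U\models|Y|\leq|[h]_U|$ and $X\subseteq Y$.
   Context: $\kappa$ is an inaccessible cardinal and $\lambda$ is a cardinal. $j_U:V\to M_U$ is the ultrapower embedding of $V$ by $U$, with $M_U$ identified with its transitive collapse, and $[h]_U\in M_U$ is the ordinal represented by $h$. Functions $h:\kappa\to\kappa$ used as parameters are assumed to take no finite values. An $h$-slalom is a function $\varphi$ whose domain is a subset of $\kappa$ with bounded complement, such that $\varphi(\alpha)\subseteq\kappa$ and $|\varphi(\alpha)|=|h(\alpha)|$ for all $\alpha\in\mathrm{dom}(\varphi)$. For $f:\kappa\to\kappa$, write $f\in^*\varphi$ if $\{\alpha\in\mathrm{dom}(\varphi): f(\alpha)\notin\varphi(\alpha)\}$ is bounded in $\kappa$. $\mathfrak{b}_h(\in^* )$ is the least cardinality of a family $\mathcal F\subseteq\kappa^\kappa$ such that for every $h$-slalom $\varphi$ there is $f\in\mathcal F$ with $\neg(f\in^*\varphi)$.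
   Formalization: The ultrafilter U is additionally assumed uniform (every member has size κ); without this the claim fails, e.g. for U principal at 0, h(α)=|α|+ω, λ=κ⁺ and X=κ. *)

(* Defs.v *)
(* All set-theoretic notions are defined for an arbitrary structure (N, ∈), so
   that they can be read both in the universe V and in the inner model M_U:
   "M_U satisfies phi" is phi interpreted in the structure M_U. *)

Set Implicit Arguments.
Unset Strict Implicit.
Unset Printing Implicit Defensive.

Record eps_structure := EpsStructure {
  carrier :> Type;
  mem : carrier -> carrier -> Prop
}.

Declare Scope eps_scope.
Notation "x ∈ y" := (mem x y) (at level 70, no associativity) : eps_scope.
Notation "x ∉ y" := (~ mem x y) (at level 70, no associativity) : eps_scope.
Open Scope eps_scope.

Section SetTheory.
Variable N : eps_structure.
Implicit Types a b c f g p s t u w x y z : N.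

Definition subset x y := forall z, z ∈ x -> z ∈ y.
Definition is_empty x := forall z, z ∉ x.
Definition nonempty x := exists z, z ∈ x.
Definition is_upair p a b := forall z, z ∈ p <-> z = a \/ z = b.
Definition is_union u x := forall z, z ∈ u <-> exists y, y ∈ x /\ z ∈ y.
Definition is_power p x := forall z, z ∈ p <-> subset z x.
Definition is_succ s x := forall z, z ∈ s <-> z ∈ x \/ z = x.

(* p is the Kuratowski pair {{a}, {a, b}}. *)
Definition is_opair p a b :=
  exists s t, is_upair s a a /\ is_upair t a b /\ is_upair p s t.

(* f(x) = y *)
Definition maps f x y := exists p, is_opair p x y /\ p ∈ f.

Definition fun_on f a :=
  (forall p, p ∈ f -> exists x y, x ∈ a /\ is_opair p x y) /\
  (forall x, x ∈ a -> exists! y, maps f x y).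

Definition is_fun f a b := fun_on f a /\ forall x y, maps f x y -> y ∈ b.

Definition is_injection f a b :=
  is_fun f a b /\ forall x x' y, maps f x y -> maps f x' y -> x = x'.

Definition is_bijection f a b :=
  is_injection f a b /\ forall y, y ∈ b -> exists x, maps f x y.

Definition card_le a b := exists f, is_injection f a b.
Definition card_eq a b := exists f, is_bijection f a b.
Definition card_lt a b := card_le a b /\ ~ card_eq a b.

(* Replacement ranges over all predicates, i.e. every class of the ambient
   logic; as R need not be total on a, it contains Separation. *)
Record ZFC : Prop := {
  zfc_extensionality : forall x y, (forall z, z ∈ x <-> z ∈ y) -> x = y;
  zfc_foundation :
    forall x, nonempty x -> exists y, y ∈ x /\ forall z, z ∈ x -> z ∉ y;
  zfc_pairing : forall a b, exists p, is_upair p a b;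
  zfc_union : forall x, exists u, is_union u x;
  zfc_power : forall x, exists p, is_power p x;
  zfc_infinity :
    exists w, (exists e, is_empty e /\ e ∈ w) /\
              (forall x, x ∈ w -> exists s, is_succ s x /\ s ∈ w);
  zfc_replacement :
    forall (R : N -> N -> Prop) a,
      (forall x y y', x ∈ a -> R x y -> R x y' -> y = y') ->
      exists b, forall y, y ∈ b <-> exists x, x ∈ a /\ R x y;
  zfc_choice :
    forall a, (forall x, x ∈ a -> nonempty x) ->
      exists f, fun_on f a /\ forall x y, maps f x y -> y ∈ x
}.

Definition transitive x := forall y, y ∈ x -> subset y x.

(* Well-foundedness of ∈ comes from Foundation. *)
Definition ordinal x :=
  transitive x /\
  forall y z, y ∈ x -> z ∈ x -> y ∈ z \/ y = z \/ z ∈ y.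

Definition limit_ordinal x :=
  ordinal x /\ nonempty x /\ forall y, y ∈ x -> exists z, z ∈ x /\ y ∈ z.

Definition is_omega w :=
  limit_ordinal w /\ forall x, x ∈ w -> ~ limit_ordinal x.

Definition cardinal x := ordinal x /\ forall y, y ∈ x -> ~ card_eq y x.

Definition regular k :=
  forall a f, a ∈ k -> is_fun f a k ->
    exists c, c ∈ k /\ forall x y, maps f x y -> y ∈ c.

Definition strong_limit k :=
  forall a p, a ∈ k -> is_power p a -> card_lt p k.

Definition inaccessible k :=
  cardinal k /\ (exists w, is_omega w /\ w ∈ k) /\ regular k /\ strong_limit k.

Definition bounded_in k (P : N -> Prop) :=
  exists c, c ∈ k /\ forall a, a ∈ k -> P a -> a ∈ c.

Definition no_finite_values h :=
  forall w x y, is_omega w -> maps h x y -> y ∉ w.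

Definition slalom k h phi :=
  exists d, subset d k /\ bounded_in k (fun a => a ∉ d) /\ fun_on phi d /\
    forall a s y, maps phi a s -> maps h a y -> subset s k /\ card_eq s y.

(* f ∈* phi *)
Definition captured k f phi :=
  bounded_in k (fun a => exists y s, maps f a y /\ maps phi a s /\ y ∉ s).

Definition uncaptured_family k h F :=
  (forall f, f ∈ F -> is_fun f k k) /\
  (forall phi, slalom k h phi -> exists f, f ∈ F /\ ~ captured k f phi).

(* b is the cardinal b_h(∈* ). *)
Definition is_b_number k h b :=
  cardinal b /\
  (exists F, uncaptured_family k h F /\ card_eq F b) /\
  (forall F, uncaptured_family k h F -> card_le b F).

Definition ultrafilter k U :=
  (forall A, A ∈ U -> subset A k) /\
  k ∈ U /\
  (forall A, A ∈ U -> nonempty A) /\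
  (forall A B, A ∈ U -> subset A B -> subset B k -> B ∈ U) /\
  (forall A B C, A ∈ U -> B ∈ U ->
     (forall x, x ∈ C <-> x ∈ A /\ x ∈ B) -> C ∈ U) /\
  (forall A B, subset A k -> (forall x, x ∈ B <-> x ∈ k /\ x ∉ A) ->
     A ∈ U \/ B ∈ U).

Definition sigma_complete U :=
  forall w S I, is_omega w -> nonempty S -> subset S U -> card_le S w ->
    (forall x, x ∈ I <-> forall A, A ∈ S -> x ∈ A) -> I ∈ U.

(* Without uniformity (e.g. U principal) U need not contain the co-bounded
   subsets of k and does not respect "modulo bounded" notions such as ∈*. *)
Definition uniform k U := forall A, A ∈ U -> card_eq A k.

(* {a < k : P a} ∈ U *)
Definition U_almost_all k U (P : N -> Prop) :=
  exists A, A ∈ U /\ forall a, a ∈ A <-> a ∈ k /\ P a.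

Definition ult_eq k U f g :=
  U_almost_all k U (fun a => exists x, maps f a x /\ maps g a x).

Definition ult_mem k U f g :=
  U_almost_all k U (fun a => exists x y, maps f a x /\ maps g a y /\ x ∈ y).

(* The transitive collapse of Ult(V, U): cl f is [f]_U, for f a function with
   domain k (other values of cl are irrelevant).  The map is an isomorphism of
   the ultrapower onto a transitive class, hence unique on such f. *)
Definition ult_collapse k U (cl : N -> N) :=
  (forall f g, fun_on f k -> fun_on g k -> (cl f = cl g <-> ult_eq k U f g)) /\
  (forall f g, fun_on f k -> fun_on g k -> (cl f ∈ cl g <-> ult_mem k U f g)) /\
  (forall f x, fun_on f k -> x ∈ cl f -> exists g, fun_on g k /\ x = cl g).

(* M_U as a structure: a transitive class of N with the membership of N. *)
Definition ult_model k (cl : N -> N) : eps_structure :=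
  @EpsStructure {x : N | exists f, fun_on f k /\ x = cl f}
    (fun r q => proj1_sig r ∈ proj1_sig q).

Definition ult_val k (cl : N -> N) (r : ult_model k cl) : N := proj1_sig r.

(* [f]_U as an element of M_U *)
Definition ult_class k (cl : N -> N) f (Hf : fun_on f k) : ult_model k cl :=
  exist _ (cl f) (ex_intro _ f (conj Hf eq_refl)).

(* z = j_U(x), the class of the constant function with value x *)
Definition is_j k (cl : N -> N) x z :=
  exists c, fun_on c k /\ (forall a, a ∈ k -> maps c a x) /\ z = cl c.

End SetTheory.

Arguments ult_class {N k} cl {f} Hf.

(* Main.v *)
From Stdlib Require Import Classical ClassicalEpsilon ProofIrrelevance.
Require Import Defs.

(** Every element of [j_U(kappa)] is the class of some [f : kappa -> kappa].
    Choosing one such [f] for each element of [X] gives a family of size at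
    most [|X| < lambda <= b_h(∈* )], hence too small to be uncaptured: a single
    [h]-slalom [phi] captures all of it.  The witness is [Y = [phi]_U].

    - [X] is contained in [Y].  If [x = [f]_U] with [f ∈* phi], then
      [f(a) ∈ phi(a)] for all [a] outside a bounded set.  As [U] is uniform and
      [kappa] is a cardinal, bounded sets are [U]-null
      ([almost_all_of_bounded]), so [[f]_U ∈ [phi]_U].
    - [|Y| <= |[h]_U|] holds in [M_U].  For [a] in the domain of [phi] choose
      an injection [g(a)] of [phi(a)] into [h(a)].  By Los's theorem for the
      formula defining injections ([los_injection]), [[g]_U] is, in [M_U], an
      injection of [[phi]_U] into [[h]_U].

    That the family is small is used by contradiction: otherwise
    [lambda <= b <= |X|], and the Cantor-Bernstein theorem
    ([card_le_antisym]), applied to [X] and [lambda], contradicts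
    [|X| < lambda].

    Functions of the universe with a given domain are handled as operations
    [V -> V] of the ambient logic; [value] and [graph] pass between the two. *)

Set Implicit Arguments.
Unset Strict Implicit.
Unset Printing Implicit Defensive.

(** * Functions as sets and as operations *)

Section Universe.
Context (V : eps_structure) (HV : ZFC V).
Implicit Types a b f k p x y z : V.

Lemma separation a (P : V -> Prop) : exists b, forall z, z ∈ b <-> z ∈ a /\ P z.
Proof.
  destruct (zfc_replacement HV (R := fun x y => x = y /\ P x) (a := a))
    as [b Hb].
  - intros x y y' _ [<- _] [<- _]; reflexivity.
  - exists b; intro z; rewrite Hb; split.
    + intros [x [Hx [<- Px]]]; auto.
    + intros [Hz Pz]; exists z; auto.
Qed.

Lemma image_exists a (F : V -> V) :
  exists b, forall y, y ∈ b <-> exists x, x ∈ a /\ y = F x.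
Proof.
  apply (zfc_replacement HV (R := fun x y => y = F x)).
  intros x y y' _ -> ->; reflexivity.
Qed.

Lemma opair_exists x y : exists p, is_opair p x y.
Proof.
  destruct (zfc_pairing HV x x) as [s Hs], (zfc_pairing HV x y) as [t Ht],
    (zfc_pairing HV s t) as [p Hp].
  exists p, s, t; auto.
Qed.

(** The first component is the only set that belongs to every element of the
    pair; the second is then read off from the elements of its elements. *)
Lemma opair_inj p x y x' y' :
  is_opair p x y -> is_opair p x' y' -> x = x' /\ y = y'.
Proof.
  intros [s [t [Hs [Ht Hp]]]] [s' [t' [Hs' [Ht' Hp']]]].
  assert (Hcommon : forall z, z ∈ p -> x' ∈ z).
  { intros z Hz; apply Hp' in Hz as [-> | ->]; [apply Hs' | apply Ht']; auto. }
  assert (Ex : x = x').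
  { assert (Hx : x' ∈ s) by (apply Hcommon, Hp; auto).
    apply Hs in Hx as [-> | ->]; reflexivity. }
  subst x'; split; [reflexivity |].
  assert (Hy : y = x \/ y = y').
  { assert (Hy : t ∈ p) by (apply Hp; auto).
    assert (y ∈ t) by (apply Ht; auto).
    apply Hp' in Hy as [-> | ->]; [left | apply Ht'; assumption].
    destruct (proj1 (Hs' y)); auto. }
  assert (Hy' : y' = x \/ y' = y).
  { assert (Hy' : t' ∈ p) by (apply Hp'; auto).
    assert (y' ∈ t') by (apply Ht'; auto).
    apply Hp in Hy' as [-> | ->]; [left | apply Ht; assumption].
    destruct (proj1 (Hs y')); auto. }
  destruct Hy, Hy'; congruence.
Qed.

Definition value f x : V := epsilon (inhabits x) (maps f x).

Lemma maps_value f a x : fun_on f a -> x ∈ a -> maps f x (value f x).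
Proof.
  intros [_ Hf] Hx; destruct (Hf x Hx) as [y [Hy _]].
  unfold value; apply epsilon_spec; exists y; exact Hy.
Qed.

Lemma fun_on_maps f a x y : fun_on f a -> maps f x y -> x ∈ a /\ y = value f x.
Proof.
  intros Hf Hxy.
  assert (Hx : x ∈ a).
  { destruct Hxy as [p [Hp Hpf]].
    destruct (proj1 Hf p Hpf) as [x0 [y0 [Hx0 Hp0]]].
    destruct (opair_inj Hp Hp0) as [-> _]; exact Hx0. }
  split; [exact Hx |].
  destruct (proj2 Hf x Hx) as [y0 [_ Huniq]].
  rewrite <- (Huniq _ Hxy); apply Huniq; exact (maps_value Hf Hx).
Qed.

Lemma graph_exists a (F : V -> V) :
  exists f, fun_on f a /\ forall x y, maps f x y <-> x ∈ a /\ y = F x.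
Proof.
  pose (code := fun x => epsilon (inhabits x) (fun p => is_opair p x (F x))).
  assert (Hcode : forall x, is_opair (code x) x (F x))
    by (intro x; unfold code; apply epsilon_spec, opair_exists).
  destruct (image_exists a code) as [f Hf].
  assert (Hmaps : forall x y, maps f x y <-> x ∈ a /\ y = F x).
  { intros x y; split.
    - intros [p [Hp Hpf]]; apply Hf in Hpf as [x0 [Hx0 ->]].
      destruct (opair_inj Hp (Hcode x0)) as [-> ->]; auto.
    - intros [Hx ->]; exists (code x); split; [apply Hcode |].
      apply Hf; exists x; auto. }
  exists f; split; [split | exact Hmaps].
  - intros p Hp; apply Hf in Hp as [x [Hx ->]]; exists x, (F x); auto.
  - intros x Hx; exists (F x); split; [apply Hmaps; auto |].
    intros y Hy; apply Hmaps in Hy as [_ ->]; reflexivity.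
Qed.

Definition graph a (F : V -> V) : V :=
  epsilon (inhabits a)
    (fun f => fun_on f a /\ forall x y, maps f x y <-> x ∈ a /\ y = F x).

Lemma graph_fun_on a F : fun_on (graph a F) a.
Proof. exact (proj1 (epsilon_spec _ _ (graph_exists a F))). Qed.

Lemma maps_graph a F x y : maps (graph a F) x y <-> x ∈ a /\ y = F x.
Proof. exact (proj2 (epsilon_spec _ _ (graph_exists a F)) x y). Qed.

(** * Comparison of cardinalities *)

Definition inj_on a b (F : V -> V) :=
  (forall x, x ∈ a -> F x ∈ b) /\
  (forall x x', x ∈ a -> x' ∈ a -> F x = F x' -> x = x').

Lemma inj_on_graph a b F : inj_on a b F -> is_injection (graph a F) a b.
Proof.
  intros [Hb Hinj]; repeat split; try apply graph_fun_on.
  - intros x y Hxy; apply maps_graph in Hxy as [Hx ->]; auto.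
  - intros x x' y Hx Hx'; apply maps_graph in Hx as [Hx ->].
    apply maps_graph in Hx' as [Hx' E]; auto.
Qed.

Lemma card_leP a b : card_le a b <-> exists F, inj_on a b F.
Proof.
  split.
  - intros [f [[Hf Hb] Hinj]]; exists (value f); split.
    + intros x Hx; exact (Hb _ _ (maps_value Hf Hx)).
    + intros x x' Hx Hx' E; apply (Hinj x x' (value f x)).
      * exact (maps_value Hf Hx).
      * rewrite E; exact (maps_value Hf Hx').
  - intros [F HF]; exists (graph a F); apply inj_on_graph, HF.
Qed.

Lemma card_le_trans a b c : card_le a b -> card_le b c -> card_le a c.
Proof.
  rewrite !card_leP; intros [F [HF Finj]] [G [HG Ginj]].
  exists (fun x => G (F x)); split; auto.
Qed.

Lemma subset_card_le a b : subset a b -> card_le a b.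
Proof. intro Hab; apply card_leP; exists (fun x => x); split; auto. Qed.

Lemma card_eq_ge a b : card_eq a b -> card_le b a.
Proof.
  intros [f [[[Hf _] _] Hsurj]]; apply card_leP.
  pose (G := fun y => epsilon (inhabits y) (fun x => maps f x y)).
  assert (HG : forall y, y ∈ b -> maps f (G y) y)
    by (intros y Hy; unfold G; apply epsilon_spec, Hsurj, Hy).
  exists G; split.
  - intros y Hy; exact (proj1 (fun_on_maps Hf (HG y Hy))).
  - intros y y' Hy Hy' E.
    rewrite (proj2 (fun_on_maps Hf (HG y Hy))), E.
    symmetry; exact (proj2 (fun_on_maps Hf (HG y' Hy'))).
Qed.

(** For [F : a -> b] and [G : b -> a]: the points of [a] whose backward orbit
    under [F] and [G] stops in [a].  The Cantor-Bernstein bijection is [F] on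
    these points and the inverse of [G] on the others. *)
Inductive starts_in a b (F G : V -> V) : V -> Prop :=
| starts_in_base x :
    x ∈ a -> (forall y, y ∈ b -> x <> G y) -> starts_in a b F G x
| starts_in_step x : starts_in a b F G x -> starts_in a b F G (G (F x)).

Lemma card_le_antisym a b : card_le a b -> card_le b a -> card_eq a b.
Proof.
  rewrite !card_leP; intros [F [HF Finj]] [G [HG Ginj]].
  pose (C := starts_in a b F G).
  assert (HCa : forall x, C x -> x ∈ a) by (induction 1; auto).
  pose (Ginv := fun x => epsilon (inhabits x) (fun y => y ∈ b /\ G y = x)).
  assert (HGinv : forall x, x ∈ a -> ~ C x -> Ginv x ∈ b /\ G (Ginv x) = x).
  { intros x Hx HC; unfold Ginv; apply epsilon_spec, NNPP; intro Hno.
    apply HC; constructor; [exact Hx |].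
    intros y Hy ->; apply Hno; exists y; auto. }
  pose (H := fun x =>
    if excluded_middle_informative (C x) then F x else Ginv x).
  (* A value [F x] with [C x] is never [Ginv x'] with [~ C x'], because
     [C] is closed under [G] after [F]. *)
  assert (Hsep : forall x x', C x -> x' ∈ a -> ~ C x' -> F x <> Ginv x').
  { intros x x' HC Hx' HC' E; apply HC'.
    rewrite <- (proj2 (HGinv x' Hx' HC')), <- E; constructor; exact HC. }
  assert (HH : inj_on a b H).
  { split; unfold H.
    - intros x Hx; destruct (excluded_middle_informative (C x)); [auto |].
      apply HGinv; auto.
    - intros x x' Hx Hx'.
      destruct (excluded_middle_informative (C x)) as [HC | HC],
        (excluded_middle_informative (C x')) as [HC' | HC']; intro E.
      + auto.
      + destruct (Hsep x x' HC Hx' HC' E).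
      + destruct (Hsep x' x HC' Hx HC (eq_sym E)).
      + rewrite <- (proj2 (HGinv x Hx HC)), E; apply HGinv; auto. }
  exists (graph a H); split; [apply inj_on_graph, HH |].
  intros y Hy; destruct (classic (C (G y))) as [HC | HC].
  - inversion HC as [x Hx Hno E | x HCx E].
    + destruct (Hno y Hy eq_refl).
    + exists x; apply maps_graph; split; [auto |].
      unfold H; destruct (excluded_middle_informative (C x));
        [auto | contradiction].
  - exists (G y); apply maps_graph; split; [auto |].
    unfold H; destruct (excluded_middle_informative (C (G y)));
      [contradiction |].
    destruct (HGinv (G y)); auto.
Qed.

(** * Ultrafilters as quantifiers *)

Section Ultrapower.
Context (k U : V) (HU : ultrafilter k U).

Notation almost_all := (U_almost_all k U).

Lemma almost_all_intro (P : V -> Prop) :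
  (forall a, a ∈ k -> P a) -> almost_all P.
Proof.
  intro HP; exists k; split; [apply HU |]; intro a; split; auto; tauto.
Qed.

Lemma almost_all_mono (P Q : V -> Prop) :
  (forall a, a ∈ k -> P a -> Q a) -> almost_all P -> almost_all Q.
Proof.
  intros HPQ [A [HA EA]]; destruct (separation k Q) as [B HB].
  exists B; split; [| exact HB].
  destruct HU as [_ [_ [_ [Hup _]]]]; apply (Hup A B HA).
  - intros a Ha; apply HB; apply EA in Ha as [Ha Pa]; auto.
  - intros a Ha; apply HB in Ha; tauto.
Qed.

Lemma almost_all_and (P Q : V -> Prop) :
  almost_all P -> almost_all Q -> almost_all (fun a => P a /\ Q a).
Proof.
  intros [A [HA EA]] [B [HB EB]].
  destruct (separation k (fun a => P a /\ Q a)) as [C HC].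
  exists C; split; [| exact HC].
  destruct HU as [_ [_ [_ [_ [Hcap _]]]]]; apply (Hcap A B C HA HB).
  intro a; rewrite HC, EA, EB; tauto.
Qed.

Lemma almost_all_not (P : V -> Prop) :
  almost_all (fun a => ~ P a) <-> ~ almost_all P.
Proof.
  split.
  - intros Hn Hp; destruct (almost_all_and Hn Hp) as [A [HA EA]].
    destruct HU as [_ [_ [Hne _]]]; destruct (Hne A HA) as [a Ha].
    apply EA in Ha; tauto.
  - intro Hn; destruct (separation k P) as [A HA],
      (separation k (fun a => ~ P a)) as [B HB].
    destruct HU as [_ [_ [_ [_ [_ Hmax]]]]].
    destruct (Hmax A B) as [H | H].
    + intros a Ha; apply HA in Ha; tauto.
    + intro a; rewrite HB, HA; tauto.
    + destruct Hn; exists A; auto.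
    + exists B; auto.
Qed.

(** A bounded set in [U] would have size [k] by uniformity, yet it is contained
    in some [c ∈ k], and [k] is a cardinal. *)
Lemma almost_all_of_bounded (P : V -> Prop) :
  cardinal k -> uniform k U -> bounded_in k P -> almost_all (fun a => ~ P a).
Proof.
  intros [[Htrans _] Hcard] Hunif [c [Hc HP]].
  apply almost_all_not; intros [A [HA EA]].
  apply (Hcard c Hc), card_le_antisym.
  - apply subset_card_le, Htrans, Hc.
  - apply (card_le_trans (card_eq_ge (Hunif A HA))), subset_card_le.
    intros a Ha; apply EA in Ha as [Ha Pa]; auto.
Qed.

(** * Los's theorem *)

Context (cl : V -> V) (Hcl : ult_collapse k U cl).

Notation M := (ult_model k cl).
Implicit Types F G : V -> V.

Definition class_of F : M := ult_class cl (graph_fun_on k F).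

Lemma ult_model_eq (r q : M) : ult_val r = ult_val q -> r = q.
Proof.
  destruct r as [r Hr], q as [q Hq]; simpl; intros <-.
  f_equal; apply proof_irrelevance.
Qed.

Lemma cl_graph_value f : fun_on f k -> cl f = cl (graph k (value f)).
Proof.
  intro Hf; apply (proj1 Hcl); [exact Hf | apply graph_fun_on |].
  apply almost_all_intro; intros a Ha; exists (value f a); split.
  - exact (maps_value Hf Ha).
  - apply maps_graph; auto.
Qed.

Lemma ult_class_value f (Hf : fun_on f k) :
  ult_class cl Hf = class_of (value f).
Proof. apply ult_model_eq, cl_graph_value, Hf. Qed.

Lemma class_of_surj (m : M) : exists F, m = class_of F.
Proof.
  destruct m as [x [f [Hf ->]]]; exists (value f).
  apply ult_model_eq, cl_graph_value, Hf.
Qed.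

(** [los A P] is the conclusion of Los's theorem for a statement [A] about
    classes [[F]_U] in [M_U] and the corresponding statement [P a] about the
    values [F a].  One lemma for each logical symbol replaces the induction on
    formulas. *)
Definition los (A : Prop) (P : V -> Prop) := A <-> almost_all P.

Lemma los_mem F G : los (class_of F ∈ class_of G) (fun a => F a ∈ G a).
Proof.
  destruct Hcl as [_ [Hmem _]]; unfold los.
  apply (iff_trans (Hmem _ _ (graph_fun_on k F) (graph_fun_on k G))).
  split; apply almost_all_mono.
  - intros a Ha [x [y [Hx [Hy Hxy]]]].
    apply maps_graph in Hx as [_ ->]; apply maps_graph in Hy as [_ ->]; auto.
  - intros a Ha H; exists (F a), (G a); rewrite !maps_graph; auto.
Qed.

Lemma los_eq F G : los (class_of F = class_of G) (fun a => F a = G a).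
Proof.
  assert (E : class_of F = class_of G <-> cl (graph k F) = cl (graph k G)).
  { split; [| exact (@ult_model_eq (class_of F) (class_of G))].
    intro E; exact (f_equal (@ult_val V k cl) E). }
  unfold los; rewrite E, (proj1 Hcl _ _ (graph_fun_on k F) (graph_fun_on k G)).
  split; apply almost_all_mono.
  - intros a Ha [x [Hx Hy]].
    apply maps_graph in Hx as [_ ->]; apply maps_graph in Hy as [_ ->]; auto.
  - intros a Ha H; exists (F a); rewrite !maps_graph; auto.
Qed.

Lemma los_ext A B (P Q : V -> Prop) :
  los A P -> (A <-> B) -> (forall a, P a <-> Q a) -> los B Q.
Proof.
  unfold los; intros HA HAB HPQ.
  apply (iff_trans (iff_sym HAB)), (iff_trans HA).
  split; apply almost_all_mono; intros a _; apply HPQ.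
Qed.

Lemma los_not A P : los A P -> los (~ A) (fun a => ~ P a).
Proof. unfold los; intro HA; rewrite almost_all_not; tauto. Qed.

Lemma los_and A B P Q : los A P -> los B Q -> los (A /\ B) (fun a => P a /\ Q a).
Proof.
  intros HA HB; split.
  - intros [Ha Hb]; apply HA in Ha; apply HB in Hb.
    exact (almost_all_and Ha Hb).
  - intro H; split; [apply HA | apply HB]; revert H; apply almost_all_mono;
      tauto.
Qed.

Lemma los_or A B P Q : los A P -> los B Q -> los (A \/ B) (fun a => P a \/ Q a).
Proof.
  intros HA HB; apply (los_ext (los_not (los_and (los_not HA) (los_not HB))));
    [| intro a]; tauto.
Qed.

Lemma los_imp A B P Q :
  los A P -> los B Q -> los (A -> B) (fun a => P a -> Q a).
Proof.
  intros HA HB; apply (los_ext (los_not (los_and HA (los_not HB))));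
    [| intro a]; tauto.
Qed.

Lemma los_iff A B P Q :
  los A P -> los B Q -> los (A <-> B) (fun a => P a <-> Q a).
Proof. intros HA HB; apply los_and; apply los_imp; assumption. Qed.

(** The witnesses for the individual [a] are collected, by choice, into a
    function representing a witness in the ultrapower. *)
Lemma los_exists (A : M -> Prop) (P : V -> V -> Prop) :
  (forall F, los (A (class_of F)) (fun a => P (F a) a)) ->
  los (exists m, A m) (fun a => exists x, P x a).
Proof.
  intro HAP; split.
  - intros [m Hm]; destruct (class_of_surj m) as [F ->].
    apply HAP in Hm; revert Hm; apply almost_all_mono.
    intros a _ H; exists (F a); exact H.
  - intro H.
    exists (class_of (fun a => epsilon (inhabits a) (fun x => P x a))).
    apply HAP; revert H; apply almost_all_mono.
    intros a _ H; exact (epsilon_spec _ _ H).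
Qed.

Lemma los_forall (A : M -> Prop) (P : V -> V -> Prop) :
  (forall F, los (A (class_of F)) (fun a => P (F a) a)) ->
  los (forall m, A m) (fun a => forall x, P x a).
Proof.
  intro HAP.
  assert (H := los_exists (A := fun m => ~ A m) (P := fun x a => ~ P x a)
                 (fun F => los_not (HAP F))).
  apply (los_ext (los_not H)); [| intro a]; split.
  - intros Hno m; apply NNPP; intro Hm; apply Hno; exists m; exact Hm.
  - intros Hall [m Hm]; exact (Hm (Hall m)).
  - intros Hno x; apply NNPP; intro Hx; apply Hno; exists x; exact Hx.
  - intros Hall [x Hx]; exact (Hx (Hall x)).
Qed.

Ltac los_step :=
  first [ apply los_mem | apply los_eq | apply los_and | apply los_or
        | apply los_iff | apply los_imp | apply los_exists; intro
        | apply los_forall; intro ].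

Lemma los_upair P F G :
  los (is_upair (class_of P) (class_of F) (class_of G))
      (fun a => is_upair (P a) (F a) (G a)).
Proof. unfold is_upair; repeat los_step. Qed.

Lemma los_opair P F G :
  los (is_opair (class_of P) (class_of F) (class_of G))
      (fun a => is_opair (P a) (F a) (G a)).
Proof. unfold is_opair; repeat (apply los_upair || los_step). Qed.

Lemma los_maps H F G :
  los (maps (class_of H) (class_of F) (class_of G))
      (fun a => maps (H a) (F a) (G a)).
Proof. unfold maps; repeat (apply los_opair || los_step). Qed.

Lemma los_injection H F G :
  los (is_injection (class_of H) (class_of F) (class_of G))
      (fun a => is_injection (H a) (F a) (G a)).
Proof.
  unfold is_injection, is_fun, fun_on, unique.
  repeat (apply los_opair || apply los_maps || los_step).
Qed.

Lemma los_card_le F G :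
  los (card_le (class_of F) (class_of G)) (fun a => card_le (F a) (G a)).
Proof. apply los_exists; intro H; apply los_injection. Qed.

(** A representative of an element of [j_U(k)] has values in [k] almost
    everywhere; the other values may be changed arbitrarily, for instance to
    the argument itself. *)
Lemma mem_is_j_fun jk x :
  is_j k cl k jk -> x ∈ jk -> exists f, is_fun f k k /\ x = cl f.
Proof.
  intros [c [Hc [Hconst ->]]] Hx.
  destruct Hcl as [_ [_ Htrans]]; destruct (Htrans c x Hc Hx) as [g [Hg ->]].
  assert (Hgk : almost_all (fun a => value g a ∈ k)).
  { destruct Hcl as [_ [Hmem _]]; apply (Hmem g c Hg Hc) in Hx; revert Hx.
    apply almost_all_mono; intros a Ha [y [z [Hy [Hz Hyz]]]].
    destruct (fun_on_maps Hg Hy) as [_ <-].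
    destruct (fun_on_maps Hc Hz) as [_ Ez].
    destruct (fun_on_maps Hc (Hconst a Ha)) as [_ Ek].
    rewrite Ek, <- Ez; exact Hyz. }
  pose (F := fun a =>
    if excluded_middle_informative (value g a ∈ k) then value g a else a).
  exists (graph k F); split.
  - split; [apply graph_fun_on |]; intros a y Hay.
    apply maps_graph in Hay as [Ha ->]; unfold F.
    destruct (excluded_middle_informative (value g a ∈ k)); assumption.
  - rewrite (cl_graph_value Hg); change (ult_val (class_of (value g)) =
      ult_val (class_of F)); f_equal; apply los_eq; revert Hgk.
    apply almost_all_mono; intros a _ Ha; unfold F.
    destruct (excluded_middle_informative (value g a ∈ k)); tauto.
Qed.

End Ultrapower.

(** * Slaloms *)

Lemma card_lt_not_uncaptured k h lambda b X Fam :
  is_b_number k h b -> card_le lambda b -> card_lt X lambda ->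
  card_le Fam X -> ~ uncaptured_family k h Fam.
Proof.
  intros [_ [_ Hmin]] Hle [HX Hne] HFam Hunc; apply Hne, card_le_antisym.
  - exact HX.
  - exact (card_le_trans Hle (card_le_trans (Hmin Fam Hunc) HFam)).
Qed.

Lemma exists_capturing_slalom k h Fam :
  (forall f, f ∈ Fam -> is_fun f k k) -> ~ uncaptured_family k h Fam ->
  exists phi, slalom k h phi /\ forall f, f ∈ Fam -> captured k f phi.
Proof.
  intros Hfun Hno; apply NNPP; intro Hnone; apply Hno; split; [exact Hfun |].
  intros phi Hphi; apply NNPP; intro Hall; apply Hnone; exists phi.
  split; [exact Hphi |]; intros f Hf; apply NNPP; intro Hcap.
  apply Hall; exists f; auto.
Qed.

(** Representatives [f] with [cl f = x] for the elements [x] of [X]: they form a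
    family no larger than [X], because [cl] is injective on it. *)
Lemma exists_representatives k U cl jk X :
  ultrafilter k U -> ult_collapse k U cl -> is_j k cl k jk -> subset X jk ->
  exists Fam, card_le Fam X /\ (forall f, f ∈ Fam -> is_fun f k k) /\
    forall x, x ∈ X -> exists f, f ∈ Fam /\ x = cl f.
Proof.
  intros HU Hcl Hj HX.
  pose (rep := fun x => epsilon (inhabits x) (fun f => is_fun f k k /\ x = cl f)).
  assert (Hrep : forall x, x ∈ X -> is_fun (rep x) k k /\ x = cl (rep x))
    by (intros x Hx; unfold rep; apply epsilon_spec, (mem_is_j_fun HU Hcl Hj (HX x Hx))).
  destruct (image_exists X rep) as [Fam HFam].
  exists Fam; split; [| split].
  - apply card_leP; exists cl; split.
    + intros f Hf; apply HFam in Hf as [x [Hx ->]].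
      rewrite <- (proj2 (Hrep x Hx)); exact Hx.
    + intros f f' Hf Hf'; apply HFam in Hf as [x [Hx ->]].
      apply HFam in Hf' as [x' [Hx' ->]].
      rewrite <- (proj2 (Hrep x Hx)), <- (proj2 (Hrep x' Hx')).
      intros ->; reflexivity.
  - intros f Hf; apply HFam in Hf as [x [Hx ->]]; apply Hrep, Hx.
  - intros x Hx; exists (rep x); split; [| apply Hrep, Hx].
    apply HFam; exists x; auto.
Qed.

End Universe.

Theorem proposition6p1 (V : eps_structure) (HV : ZFC V)
    (kappa lambda h b : V)
    (Hkappa : inaccessible kappa) (Hlambda : cardinal lambda)
    (Hh : is_fun h kappa kappa) (Hinf : no_finite_values h)
    (Hb : is_b_number kappa h b) (Hle : card_le lambda b) :
  forall U : V,
    ultrafilter kappa U -> sigma_complete U -> uniform kappa U ->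
  forall cl : V -> V, ult_collapse kappa U cl ->
  forall jkappa : V, is_j kappa cl kappa jkappa ->
  forall X : V, subset X jkappa -> card_lt X lambda ->
  exists Y : ult_model kappa cl,
    card_le Y (ult_class cl (proj1 Hh)) /\ subset X (ult_val Y).
Proof.
  intros U HU _ Hunif cl Hcl jk Hj X HXj HXlt.
  destruct (exists_representatives HV HU Hcl Hj HXj)
    as [Fam [HFamX [Hfun Hsurj]]].
  destruct (exists_capturing_slalom Hfun
    (card_lt_not_uncaptured HV Hb Hle HXlt HFamX)) as [phi [Hphi Hcap]].
  destruct Hphi as [d [_ [Hd [Hphi Hval]]]].
  pose proof (proj1 Hkappa) as Hcard.
  assert (Hdom : U_almost_all kappa U (fun a => a ∈ d)).
  { generalize (almost_all_of_bounded HV HU Hcard Hunif Hd).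
    apply (almost_all_mono HV HU); intros a _; apply NNPP. }
  (* Only the values of [value phi] on [d] matter, as [d] is in [U]. *)
  exists (class_of HV kappa cl (value phi)); split.
  - rewrite (ult_class_value HV HU Hcl); apply (los_card_le HV HU Hcl).
    revert Hdom; apply (almost_all_mono HV HU); intros a Ha Had.
    destruct (Hval _ _ _ (maps_value Hphi Had) (maps_value (proj1 Hh) Ha))
      as [_ [g [Hg _]]].
    exists g; exact Hg.
  - intros x Hx; destruct (Hsurj x Hx) as [f [Hf ->]].
    pose proof (proj1 (Hfun f Hf)) as Hfk.
    rewrite (cl_graph_value HV HU Hcl Hfk).
    apply (los_mem HV HU Hcl (value f) (value phi)).
    generalize (almost_all_and HV HU Hdom
      (almost_all_of_bounded HV HU Hcard Hunif (Hcap f Hf))).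
    apply (almost_all_mono HV HU); intros a Ha [Had Hin]; apply NNPP; intro Hno.
    apply Hin; exists (value f a), (value phi a).
    split; [exact (maps_value Hfk Ha) |]; split; [| exact Hno].
    exact (maps_value Hphi Had).
Qed.
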